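(* Assume that $\widetilde\Sigma=\sigma^2I_r$ with $\sigma>0$ and that $\mu$ is a Borel probability measure on $\mathcal{X}$ with $\operatorname{conv}(\operatorname{supp}(\mu))\subset V$. Then the operator $\widehat D_\mu$ is $L_{\widehat D_\mu}^{-1}$-cocoercive on $V$, where $L_{\widehat D_\mu}$ is the Lipschitz constant of $\widehat D_\mu$ on $V$, and $L_{\widehat D_\mu}\le\frac{M^2}{\sigma^2}$.
   Context: $\mathcal{X}\subset\mathbb{R}^n$ is compact and $M>0$ is fixed with $\max_{\mathbf{x}\in\mathcal{X}}\|\mathbf{x}\|\le M$. $\Sigma\in\mathbb{R}^{n\times n}$ is symmetric positive semidefinite, $V=\operatorname{ran}(\Sigma)$, $r=\operatorname{rank}(\Sigma)$, $\Pi$ is an $n\times r$ matrix whose columns form an orthonormal basis of $V$, and $\widetilde\Sigma=\Pi^\top\Sigma\Pi$. The MMSE denoiser $\widehat D_\mu:V\to V$ is $$\widehat D_\mu(\mathbf{z})=\frac{\int_{\mathcal{X}}\mathbf{x}\,\varphi(\mathbf{z}-\mathbf{x})\,d\mu(\mathbf{x})}{\int_{\mathcal{X}}\varphi(\mathbf{z}-\mathbf{x})\,d\mu(\mathbf{x})},\qquad \varphi(\mathbf{v})=\exp\big(-\tfrac12\mathbf{v}^\top\Pi\widetilde\Sigma^{-1}\Pi^\top\mathbf{v}\big).$$ An operator $T:V\to V$ is $\beta$-cocoercive ($\beta>0$) if $\langle T(\mathbf{x})-T(\mathbf{z}),\mathbf{x}-\mathbf{z}\rangle\ge\beta\|T(\mathbf{x})-T(\mathbf{z})\|^2$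 for all $\mathbf{x},\mathbf{z}\in V$ (Euclidean inner product and norm). *)

(* Defs.v *)
From HB Require Import structures.
From mathcomp Require Import all_boot all_order all_algebra.
From mathcomp Require Import all_classical all_reals all_analysis.
Set Implicit Arguments. Unset Strict Implicit. Unset Printing Implicit Defensive.
Import Order.TTheory GRing.Theory Num.Theory.
Import numFieldNormedType.Exports.
Local Open Scope classical_set_scope.
Local Open Scope ring_scope.

(* The library's norm on matrices is the sup norm, hence the Euclidean one
   is introduced here; the topology of 'cV[R]_n is the usual one. *)
Definition dotv (R : realType) (n : nat) (u v : 'cV[R]_n) : R :=
  \sum_(i < n) u i 0 * v i 0.

Definition enorm (R : realType) (n : nat) (v : 'cV[R]_n) : R :=
  Num.sqrt (dotv v v).

Definition borelV (R : realType) (n : nat) :=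
  g_sigma_algebraType (@open 'cV[R]_n).

Definition symmetric_psd (R : realType) (n : nat) (S : 'M[R]_n) : Prop :=
  S^T = S /\ forall v : 'cV[R]_n, 0 <= dotv v (S *m v).

Definition ran (R : realType) (m n : nat) (A : 'M[R]_(m, n)) : set 'cV[R]_m :=
  range (fun u : 'cV[R]_n => A *m u).

(* [ran P] is the span of the columns of [P]. *)
Definition orthonormal_basis_cols (R : realType) (n r : nat)
    (V : set 'cV[R]_n) (P : 'M[R]_(n, r)) : Prop :=
  (forall i j : 'I_r, dotv (col i P) (col j P) = (i == j)%:R) /\ ran P = V.

Definition reduced_cov (R : realType) (n r : nat)
    (Sigma : 'M[R]_n) (P : 'M[R]_(n, r)) : 'M[R]_r := P^T *m Sigma *m P.

Definition supp (R : realType) (n : nat)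
    (mu : probability (borelV R n) R) : set 'cV[R]_n :=
  [set x | forall U : set 'cV[R]_n, open U -> U x -> (0 < mu U)%E].

Definition conv_hull (R : realType) (n : nat) (A : set 'cV[R]_n) :
    set 'cV[R]_n :=
  smallest (@convex_set R 'cV[R]_n) A.

Definition gauss_kernel (R : realType) (n r : nat)
    (Sigma : 'M[R]_n) (P : 'M[R]_(n, r)) (v : 'cV[R]_n) : R :=
  expR (- 2^-1 *
    (v^T *m P *m invmx (reduced_cov Sigma P) *m P^T *m v) 0 0).

(* The vector-valued integral is taken coordinatewise; the formula makes sense
   on all of R^n, but it is only used on the range of [Sigma]. *)
Definition mmse (R : realType) (n r : nat) (X : set 'cV[R]_n)
    (Sigma : 'M[R]_n) (P : 'M[R]_(n, r)) (mu : probability (borelV R n) R)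
    (z : 'cV[R]_n) : 'cV[R]_n :=
  (\int[mu]_(x in X) gauss_kernel Sigma P (z - (x : 'cV[R]_n)))^-1 *:
  \col_(i < n)
    \int[mu]_(x in X)
      ((x : 'cV[R]_n) i 0 * gauss_kernel Sigma P (z - (x : 'cV[R]_n))).

Definition cocoercive_on (R : realType) (n : nat) (V : set 'cV[R]_n)
    (beta : R) (T : 'cV[R]_n -> 'cV[R]_n) : Prop :=
  [/\ 0 < beta, set_fun V V T &
    forall x z, V x -> V z ->
      beta * enorm (T x - T z) ^+ 2 <= dotv (T x - T z) (x - z)].

(* The least Lipschitz constant of [T] on [V] for the Euclidean norm; it is
   [+oo] exactly when [T] is not Lipschitz on [V]. *)
Definition lipschitz_const (R : realType) (n : nat) (V : set 'cV[R]_n)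
    (T : 'cV[R]_n -> 'cV[R]_n) : \bar R :=
  ereal_inf [set L%:E | L in [set L : R | 0 <= L /\
    forall x z, V x -> V z -> enorm (T x - T z) <= L * enorm (x - z)]].

(* Cocoercivity with modulus [L^-1]. If [L = 0] then [L^-1] is read as
   [+oo], that is, the inequality holds for every positive modulus, whereas
   the library sets [0^-1 = 0]. *)
Definition inv_cocoercive_on (R : realType) (n : nat) (V : set 'cV[R]_n)
    (L : R) (T : 'cV[R]_n -> 'cV[R]_n) : Prop :=
  (L != 0 -> cocoercive_on V L^-1 T) /\
  (L = 0 -> forall beta : R, 0 < beta -> cocoercive_on V beta T).

(* Main.v *)
(** On [V = ran Sigma] the Gaussian kernel factors as
    [c z * expR (<z, x> / s - b x)] with [s = sigma ^+ 2], so the denoiser is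
    the mean of an exponential family: it is the gradient of
    [F z = s * ln (E (expR (<z, .> / s - b)))].  Jensen's inequality gives the
    subgradient inequality for [F], and a covariance bound along a subdivided
    segment gives the Lipschitz constant [M ^+ 2 / s].  The Baillon-Haddad
    argument then turns any Lipschitz constant [L] of the gradient of a convex
    function into [L^-1]-cocoercivity.  Subdivisions of segments replace
    derivatives throughout. *)
Require Import Defs.
From HB Require Import structures.
From mathcomp Require Import all_boot all_order all_algebra.
From mathcomp Require Import all_classical all_reals all_analysis.
From mathcomp Require Import finmap measurable_realfun ring lra.
Set Implicit Arguments. Unset Strict Implicit. Unset Printing Implicit Defensive.
Import Order.TTheory GRing.Theory Num.Theory.
Import numFieldNormedType.Exports.
Local Open Scope classical_set_scope.
Local Open Scope ring_scope.

(** * Euclidean inner product and norm *)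

Section Euclidean.
Variables (R : realType) (n : nat).
Implicit Types u v w : 'cV[R]_n.

Lemma dotvC u v : dotv u v = dotv v u.
Proof. by apply: eq_bigr => i _; rewrite mulrC. Qed.

Lemma dotvDr u v w : dotv u (v + w) = dotv u v + dotv u w.
Proof. by rewrite -big_split; apply: eq_bigr => i _; rewrite mxE mulrDr. Qed.

Lemma dotvZr a u v : dotv u (a *: v) = a * dotv u v.
Proof. by rewrite mulr_sumr; apply: eq_bigr => i _; rewrite mxE mulrCA. Qed.

Lemma dotvBr u v w : dotv u (v - w) = dotv u v - dotv u w.
Proof. by rewrite dotvDr -scaleN1r dotvZr mulN1r. Qed.

Lemma dotvDl u v w : dotv (u + v) w = dotv u w + dotv v w.
Proof. by rewrite dotvC dotvDr !(dotvC w). Qed.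

Lemma dotvZl a u v : dotv (a *: u) v = a * dotv u v.
Proof. by rewrite dotvC dotvZr dotvC. Qed.

Lemma dotvBl u v w : dotv (u - v) w = dotv u w - dotv v w.
Proof. by rewrite dotvC dotvBr !(dotvC w). Qed.

Lemma dotv0r u : dotv u 0 = 0.
Proof. by rewrite -[X in dotv u X](scale0r u) dotvZr mul0r. Qed.

Lemma dotv0l u : dotv 0 u = 0. Proof. by rewrite dotvC dotv0r. Qed.

Lemma dotv_mulmx m (A : 'M[R]_(n, m)) u (v : 'cV[R]_m) :
  dotv (A^T *m u) v = dotv u (A *m v).
Proof.
rewrite /dotv; under eq_bigr do rewrite mxE mulr_suml.
rewrite exchange_big; apply: eq_bigr => i _ /=.
rewrite mxE mulr_sumr; apply: eq_bigr => j _; rewrite mxE; ring.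
Qed.

Lemma dotvv_ge0 u : 0 <= dotv u u.
Proof. by apply: sumr_ge0 => i _; rewrite -expr2 sqr_ge0. Qed.

Lemma dotvv_eq0 u : dotv u u = 0 -> u = 0.
Proof.
move=> /eqP; rewrite psumr_eq0 => [/allP u0|i _]; last by rewrite -expr2 sqr_ge0.
apply/colP => i; rewrite [RHS]mxE; have /= := u0 i (mem_index_enum i).
by rewrite mulf_eq0 orbb => /eqP.
Qed.

Lemma enorm_ge0 u : 0 <= enorm u. Proof. exact: sqrtr_ge0. Qed.

Lemma sqr_enorm u : enorm u ^+ 2 = dotv u u.
Proof. by rewrite sqr_sqrtr// dotvv_ge0. Qed.

Lemma enorm_eq0 u : enorm u = 0 -> u = 0.
Proof. by move=> u0; apply: dotvv_eq0; rewrite -sqr_enorm u0 expr0n. Qed.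

Lemma enorm0 : enorm (0 : 'cV[R]_n) = 0.
Proof. by rewrite /enorm dotv0l sqrtr0. Qed.

Lemma enormB u v : enorm (u - v) = enorm (v - u).
Proof. by congr Num.sqrt; rewrite !dotvBl !dotvBr; ring. Qed.

Lemma enormZ a u : 0 <= a -> enorm (a *: u) = a * enorm u.
Proof.
move=> a0; rewrite /enorm dotvZl dotvZr mulrA -expr2 sqrtrM ?sqr_ge0//.
by rewrite sqrtr_sqr ger0_norm.
Qed.

Lemma CauchySchwarz u v : dotv u v <= enorm u * enorm v.
Proof.
have [u0|u0] := eqVneq (enorm u) 0.
  by rewrite u0 mul0r (enorm_eq0 u0) dotv0l.
have [v0|v0] := eqVneq (enorm v) 0.
  by rewrite v0 mulr0 (enorm_eq0 v0) dotv0r.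
(* Expanding gives [2 |u| |v| (|u| |v| - <u, v>) >= 0], which is then divided by [|u| |v| > 0]. *)
have := dotvv_ge0 (enorm v *: u - enorm u *: v).
rewrite dotvBl !dotvBr !dotvZl !dotvZr (dotvC v u) -!sqr_enorm.
have uv0 : 0 < enorm u * enorm v by rewrite mulr_gt0// lt0r ?u0 ?v0 ?enorm_ge0.
move=> h; rewrite -(ler_pM2l uv0); nra.
Qed.

Lemma normr_dotv_le u v : `|dotv u v| <= enorm u * enorm v.
Proof.
rewrite ler_norml CauchySchwarz andbT lerNl -mulN1r -dotvZr.
by apply: le_trans (CauchySchwarz _ _) _; rewrite {2}/enorm dotvZl dotvZr !mulN1r opprK.
Qed.

End Euclidean.

(** Stands in for letting the mesh of a subdivision tend to 0: each estimate over [N.+1] pieces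
    carries an error [c / N.+1]. *)
Lemma ler_add_invn (R : realType) (a b c : R) :
  (forall N : nat, a <= b + c / N.+1%:R) -> a <= b.
Proof.
move=> h; rewrite leNgt; apply/negP; rewrite -subr_gt0 => ba.
have := truncnS_gt (c / (a - b)); have := h (Num.truncn (c / (a - b))).
move: (Num.truncn _) => N; rewrite ltr_pdivrMr// (mulrC N.+1%:R) -ltr_pdivrMr//.
by set t := c / _; lra.
Qed.

(** * Baillon-Haddad for a Lipschitz subgradient selection on a subspace *)

Section BaillonHaddad.
Variables (R : realType) (n : nat) (V : set 'cV[R]_n).
Variables (F : 'cV[R]_n -> R) (D : 'cV[R]_n -> 'cV[R]_n) (L : R).
Hypothesis V_closed : forall a x y, V x -> V y -> V (x + a *: y).
Hypothesis DV : forall x, V x -> V (D x).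
Hypothesis D_subgradient :
  forall x y, V x -> V y -> F x + dotv (D x) (y - x) <= F y.
Hypothesis L_ge0 : 0 <= L.
Hypothesis D_lipschitz :
  forall x y, V x -> V y -> enorm (D x - D y) <= L * enorm (x - y).

(* Summing the subgradient inequality along a subdivision of the segment
   replaces the usual integration of the derivative of [F]. *)
Lemma descent_inequality x y : V x -> V y ->
  F y <= F x + dotv (D x) (y - x) + L / 2 * enorm (y - x) ^+ 2.
Proof.
move=> Vx Vy; set d := y - x; set q := enorm d ^+ 2.
(* The sum over [N.+1] steps yields [L / 2 * q * (N + 2) / (N + 1)]; its excess over [L / 2 * q] is
   this error. *)
apply: (@ler_add_invn _ _ _ (L / 2 * q)) => N.
have Vd : V d by rewrite /d -scaleN1r; exact: V_closed.
set h : R := N.+1%:R^-1.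
have h0 : 0 <= h by rewrite invr_ge0.
pose u (k : nat) := x + (k%:R * h) *: d.
have Vu k : V (u k) by exact: V_closed.
(* The subgradient is taken at the new point [u k.+1], at distance [k.+1 * h * |d|] from [x], so the
   increments add up to triangular numbers. *)
have step k : F (u k) <=
    F x + k%:R * h * dotv (D x) d + L * h ^+ 2 * q * (k%:R * (k%:R + 1) / 2).
  elim: k => [|k ih]; first by rewrite /u !(mul0r, scale0r, mulr0, addr0).
  have := D_subgradient (Vu k.+1) (Vu k).
  have -> : u k - u k.+1 = - h *: d.
    rewrite /u opprD addrACA subrr add0r -scalerBl; congr (_ *: _).
    by rewrite -natr1; ring.
  rewrite dotvZr.
  have : dotv (D (u k.+1) - D x) d <= L * (k.+1%:R * h) * q.
    apply: le_trans (CauchySchwarz _ _) _.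
    rewrite /q expr2 mulrA ler_wpM2r ?enorm_ge0//.
    apply: le_trans (D_lipschitz (Vu _) Vx) _.
    by rewrite /u addrC addKr enormZ ?mulr_ge0// !mulrA lexx.
  rewrite dotvBl -natr1 => h1 h2.
  have := ler_wpM2l h0 h1; nra.
have := step N.+1.
have -> : u N.+1 = y by rewrite /u mulfV ?pnatr_eq0// scale1r /d addrC subrK.
move=> /le_trans; apply; rewrite /h.
have : N.+1%:R != 0 :> R by rewrite pnatr_eq0.
move: N.+1%:R => N' N0.
by rewrite le_eqVlt; apply/orP; left; apply/eqP; field.
Qed.

Lemma baillon_haddad x y : V x -> V y ->
  enorm (D x - D y) ^+ 2 <= L * dotv (D x - D y) (x - y).
Proof.
move=> Vx Vy.
have [L0|Lneq0] := eqVneq L 0.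
  have := D_lipschitz Vx Vy; rewrite L0 !mul0r => h.
  by rewrite (le_anti (_ : enorm _ <= 0 <= enorm _)) ?expr0n ?h ?enorm_ge0.
have Lgt0 : 0 < L by rewrite lt0r Lneq0.
(* A subgradient inequality sharpened by a quadratic term. The point [c] is a gradient step from
   [b]: it minimises the descent bound at [b] for [F - <D a, .>], and this is compared with the
   subgradient bound at [a]. *)
have half a b : V a -> V b ->
    F a + dotv (D a) (b - a) + (2 * L)^-1 * enorm (D b - D a) ^+ 2 <= F b.
  move=> Va Vb; set g := D b - D a; set c := b - L^-1 *: g.
  have Vg : V g by rewrite /g -scaleN1r; apply: V_closed; exact: DV.
  have Vc : V c by rewrite /c -scaleNr; exact: V_closed.
  have := D_subgradient Va Vc; have := descent_inequality Vb Vc.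
  have -> : c - b = - L^-1 *: g by rewrite /c addrC addKr scaleNr.
  have -> : dotv (D a) (c - a) = dotv (D a) (b - a) - L^-1 * dotv (D a) g.
    by rewrite -dotvZr -dotvBr /c addrAC.
  rewrite sqr_enorm !dotvZr dotvZl.
  have <- : dotv (D b) g - dotv (D a) g = dotv g g by rewrite -dotvBl.
  rewrite sqr_enorm -/g.
  have <- : dotv (D b) g - dotv (D a) g = dotv g g by rewrite -dotvBl.
  set p := dotv (D b) g; set r := dotv (D a) g; move=> h1 h2.
  have e : L / 2 * (- L^-1 * (- L^-1 * (p - r))) = (2 * L)^-1 * (p - r) by field.
  have e2 : 2 * ((2 * L)^-1 * (p - r)) = L^-1 * p - L^-1 * r by field.
  lra.
(* Adding the two inequalities cancels the values of [F]. *)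
have := half _ _ Vx Vy; have := half _ _ Vy Vx.
rewrite (enormB (D y)) [in _ <= L * _]dotvBl !dotvBr.
set p := enorm _ ^+ 2 => h1 h2.
have e : 2 * ((2 * L)^-1 * p) = p / L by field.
by rewrite mulrC -ler_pdivrMr//; lra.
Qed.

End BaillonHaddad.

(** * Abstract expectations and exponential tilting *)

Section MeanFunctional.
Variables (R : realType) (T : topologicalType) (X : set T).
Implicit Types (E : (T -> R) -> R) (f g A B : T -> R).

(** Abstracts integration of continuous functions against a probability carried by [X]. Tilted
    expectations are again of this kind, so no tilted measure has to be constructed. *)
Definition mean_functional E := [/\ E (fun=> 1) = 1,
  forall f g, continuous f -> continuous g ->
    E (fun x => f x + g x) = E f + E g,
  forall a f, continuous f -> E (fun x => a * f x) = a * E f &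
  forall f g, continuous f -> continuous g ->
    (forall x, X x -> f x <= g x) -> E f <= E g].

(* Exponential weights are positive and bounded away from 0 in mean (see
   [jensen_expR]), hence the division is always meaningful. *)
Definition tilt E B f := E (fun x => f x * expR (B x)) / E (expR \o B).

Lemma continuous_cst (a : R) : continuous (fun _ : T => a).
Proof. by move=> x; exact: cvg_cst. Qed.

Lemma continuous_addf f g : continuous f -> continuous g ->
  continuous (fun x => f x + g x).
Proof. by move=> cf cg x; apply: cvgD; [exact: cf|exact: cg]. Qed.

Lemma continuous_mulf f g : continuous f -> continuous g ->
  continuous (fun x => f x * g x).
Proof. by move=> cf cg x; apply: cvgM; [exact: cf|exact: cg]. Qed.

Lemma continuous_expf f : continuous f -> continuous (expR \o f).
Proof.
by move=> cf x; apply: continuous_comp; [exact: cf|exact: continuous_expR].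
Qed.

Lemma continuous_sumf n (f : 'I_n -> T -> R) : (forall i, continuous (f i)) ->
  continuous (fun x => \sum_(i < n) f i x).
Proof.
by move=> cf; apply: continuous_big => [|i _]; [exact: add_continuous|exact: cf].
Qed.

Local Ltac cont := repeat first [exact: continuous_cst | assumption
  | apply: continuous_addf | apply: continuous_mulf | apply: continuous_expf].

Section Theory.
Variable E : (T -> R) -> R.
Hypothesis meanE : mean_functional E.

Lemma mean1 : E (fun=> 1) = 1. Proof. by case: meanE. Qed.

Lemma meanD f g : continuous f -> continuous g ->
  E (fun x => f x + g x) = E f + E g.
Proof. by case: meanE => _ + _ _; exact. Qed.

Lemma meanZ a f : continuous f -> E (fun x => a * f x) = a * E f.
Proof. by case: meanE => _ _ + _; exact. Qed.

Lemma le_mean f g : continuous f -> continuous g ->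
  (forall x, X x -> f x <= g x) -> E f <= E g.
Proof. by case: meanE => _ _ _; exact. Qed.

Lemma mean_cst a : E (fun=> a) = a.
Proof.
rewrite -[RHS]mulr1 -mean1 -meanZ; last exact: continuous_cst.
by congr E; apply/funext => x; rewrite mulr1.
Qed.

Lemma mean_sum n (f : 'I_n -> T -> R) : (forall i, continuous (f i)) ->
  E (fun x => \sum_(i < n) f i x) = \sum_(i < n) E (f i).
Proof.
elim: n f => [|n ih] f cf.
  by rewrite big_ord0 -[RHS](mean_cst 0); congr E; apply/funext => x; rewrite big_ord0.
rewrite big_ord_recl -ih// -meanD//.
  by congr E; apply/funext => x; rewrite big_ord_recl.
by apply: continuous_sumf => i.
Qed.

(** The tangent of [expR] at [m = E f] lies below [expR], and its value along [f] has mean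
    [expR m]. *)
Lemma jensen_expR f : continuous f -> expR (E f) <= E (expR \o f).
Proof.
move=> cf; set m := E f.
have cef : continuous (fun x => expR m * f x).
  by apply: continuous_mulf => //; exact: continuous_cst.
have -> : expR m = E (fun x => expR m * (1 - m) + expR m * f x).
  rewrite meanD ?mean_cst ?meanZ// -/m; first by ring.
  exact: continuous_cst.
apply: le_mean.
- by apply: continuous_addf => //; exact: continuous_cst.
- exact: continuous_expf.
- move=> x _ /=.
  rewrite -mulrDr -[in leRHS](subrK m (f x)) expRD mulrC ler_wpM2r ?expR_ge0//.
  by apply: le_trans (expR_ge1Dx _); rewrite -addrA lerD2l addrC.
Qed.

Lemma mean_expR_gt0 f : continuous f -> 0 < E (expR \o f).
Proof. by move=> cf; apply: lt_le_trans (jensen_expR cf); exact: expR_gt0. Qed.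

Lemma mean_functional_tilt B : continuous B -> mean_functional (tilt E B).
Proof.
move=> cB; have cw := continuous_expf cB; have w0 := mean_expR_gt0 cB.
split=> [|f g cf cg|a f cf|f g cf cg fg]; rewrite /tilt.
- have -> : (fun x => 1 * expR (B x)) = expR \o B.
    by apply/funext => x; rewrite mul1r.
  by rewrite divff ?gt_eqF.
- rewrite -mulrDl -meanD; [|exact: continuous_mulf..].
  by congr (E _ / _); apply/funext => x; rewrite mulrDl.
- rewrite mulrA -meanZ; last exact: continuous_mulf.
  by congr (E _ / _); apply/funext => x; rewrite mulrA.
- rewrite ler_pM2r ?invr_gt0//; apply: le_mean; [exact: continuous_mulf..|].
  by move=> x Xx; rewrite ler_wpM2r ?expR_ge0// fg.
Qed.

(* [E (A Y) - E A * E Y = E ((A - a) (Y - 1))] with [a = E A] and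
   [Y = expR B], where [`|Y - 1| <= k := expR t - 1] and
   [`|A - a| <= (A - a) ^ 2 / (2 m) + m / 2]; the expectation of the latter is
   at most [m] because the variance of [A] is at most [m ^ 2]. *)
Lemma tilt_sub_le A B (m t : R) : continuous A -> continuous B ->
  0 < m -> 0 <= t -> (forall x, X x -> `|A x| <= m) ->
  (forall x, X x -> `|B x| <= t) ->
  tilt E B A - E A <= m * t * expR t ^+ 2.
Proof.
move=> cA cB m0 t0 Am Bt; set a := E A; set k := expR t - 1.
have cY := continuous_expf cB; set Y := expR \o B in cY *.
have Yt x : X x -> expR (- t) <= Y x <= expR t.
  by move=> /Bt; rewrite !ler_expR -ler_norml.
have et1 : 1 <= expR t by rewrite -expR0 ler_expR.
have eVe : expR (- t) * expR t = 1 by rewrite -expRD addNr expR0.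
have et0 : 0 < expR (- t) by exact: expR_gt0.
(* Multiply [1 - t <= expR (- t)] by [expR t]. *)
have k_le : k <= t * expR t.
  have := expR_ge1Dx (- t); rewrite /k; nra.
have cAA : continuous (fun x => A x * A x) by exact: continuous_mulf.
have cAY : continuous (fun x => A x * Y x) by exact: continuous_mulf.
have EY : expR (- t) <= E Y.
  by rewrite -[leLHS]mean_cst; apply: le_mean; [by cont..|] => x /Yt /andP[].
have EAA : E (fun x => A x * A x) <= m ^+ 2.
  rewrite -[leRHS]mean_cst; apply: le_mean; [by cont..|] => x /Am.
  rewrite ler_norml => /andP[? ?]; nra.
have cov : E (fun x => A x * Y x) - a * E Y <= k * m.
  have -> : E (fun x => A x * Y x) - a * E Y =
      E (fun x => A x * Y x + (- a * Y x + (- 1 * A x + a))).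
    rewrite !meanD ?meanZ ?mean_cst -/a//; try (by cont).
    by ring.
  (* This is [k * ((A - a) ^ 2 / m + m) / 2], expanded in powers of [A] so that linearity of [E]
     applies. *)
  apply: (@le_trans _ _ (E (fun x => k / (2 * m) * (A x * A x) +
      (- (a * k / m) * A x + (k / (2 * m) * a ^+ 2 + k * m / 2))))).
    apply: le_mean; [by cont..|].
    move=> x Xx; have /andP[Y1 Y2] := Yt _ Xx.
    set d := A x - a.
    have -> : A x * Y x + (- a * Y x + (-1 * A x + a)) = d * (Y x - 1).
      by rewrite /d; ring.
    have -> : k / (2 * m) * (A x * A x) + (- (a * k / m) * A x +
        (k / (2 * m) * a ^+ 2 + k * m / 2)) = k * (d ^+ 2 / m + m) / 2.
      by rewrite /d; field; rewrite gt_eqF.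
    have Yk : `|Y x - 1| <= k.
      rewrite ler_norml; apply/andP; split; last by rewrite lerD2r.
      by rewrite /k; nra.
    apply: le_trans (ler_norm _) _; rewrite normrM.
    apply: (@le_trans _ _ (`|d| * k)); first by rewrite ler_wpM2l.
    have k0 : 0 <= k by rewrite subr_ge0.
    rewrite mulrC -mulrA ler_wpM2l// ler_pdivlMr//.
    have -> : d ^+ 2 / m + m = (`|d| ^+ 2 + m ^+ 2) / m.
      by rewrite real_normK ?num_real//; field; rewrite gt_eqF.
    by rewrite ler_pdivlMr//; have := sqr_ge0 (`|d| - m); nra.
  rewrite !meanD ?meanZ ?mean_cst -/a//; try (by cont).
  set S := E _ in EAA *.
  have -> : k / (2 * m) * S + (- (a * k / m) * a + (k / (2 * m) * a ^+ 2 + k * m / 2))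
      = k * ((S - a ^+ 2) / m + m) / 2.
    by field; rewrite gt_eqF.
  have k0 : 0 <= k by rewrite subr_ge0.
  rewrite -mulrA ler_wpM2l// ler_pdivrMr// mulr_natr mulr2n lerD2r ler_pdivrMr//.
  by have := sqr_ge0 a; rewrite -expr2; lra.
have EY0 : 0 < E Y by exact: lt_le_trans EY.
rewrite /tilt -/Y -(ler_pM2r EY0) mulrBl mulfVK ?gt_eqF//.
apply: le_trans cov _.
(* Dividing the covariance by [E Y >= expR (- t)] costs the second factor [expR t]. *)
have h1 : 1 <= expR t * E Y by nra.
have h2 : 0 <= m * t * expR t by rewrite !mulr_ge0 ?expR_ge0// ltW.
apply: (@le_trans _ _ (m * t * expR t)); first by rewrite mulrC -mulrA ler_pM2l.
by rewrite expr2 -!(mulrA (m * t)) -!mulrA; nra.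
Qed.

End Theory.
End MeanFunctional.

(** * The exponential family and its mean *)

Section ExponentialFamily.
Variables (R : realType) (n : nat) (X : set 'cV[R]_n) (M s : R).
Variables (E : ('cV[R]_n -> R) -> R) (b : 'cV[R]_n -> R).
Hypothesis meanE : mean_functional X E.
Hypothesis b_continuous : continuous b.
Hypotheses (s_gt0 : 0 < s) (M_gt0 : 0 < M).
Hypothesis X_bounded : forall x, X x -> enorm x <= M.
Implicit Types (x y z u e : 'cV[R]_n) (f : 'cV[R]_n -> R).

(** Logarithm of the kernel up to a term in [z] alone, which cancels in the quotient; [b] absorbs
    the term quadratic in [x]. *)
Definition exponent z x := s^-1 * dotv z x - b x.

Definition posterior_mean z : 'cV[R]_n :=
  \col_(i < n) tilt E (exponent z) (fun x => x i 0).

Definition log_partition z := s * ln (E (expR \o exponent z)).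

Lemma continuous_dotv e : continuous (dotv e).
Proof.
apply: continuous_sumf => i; apply: continuous_mulf; first exact: continuous_cst.
exact: coord_continuous.
Qed.

Lemma continuous_linear_form a e : continuous (fun x => a * dotv e x).
Proof.
by apply: continuous_mulf; [exact: continuous_cst|exact: continuous_dotv].
Qed.

Lemma continuous_exponent z : continuous (exponent z).
Proof.
have -> : exponent z = (fun x => s^-1 * dotv z x + -1 * b x).
  by apply/funext => x; rewrite mulN1r.
apply: continuous_addf; first exact: continuous_linear_form.
by apply: continuous_mulf => //; exact: continuous_cst.
Qed.
Local Hint Resolve continuous_exponent : core.

Let mean_tilt z := mean_functional_tilt meanE (@continuous_exponent z).

Lemma dotv_posterior_mean e z :
  dotv e (posterior_mean z) = tilt E (exponent z) (dotv e).
Proof.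
rewrite /dotv (mean_sum (mean_tilt z)) => [|i].
  apply: eq_bigr => i _; rewrite mxE (meanZ (mean_tilt z))//.
  exact: coord_continuous.
by apply: continuous_mulf; [exact: continuous_cst|exact: coord_continuous].
Qed.

Lemma exponentD z u x : exponent (z + u) x = exponent z x + s^-1 * dotv u x.
Proof. by rewrite /exponent dotvDl mulrDr addrAC. Qed.

Lemma partitionD z u : E (expR \o exponent (z + u)) = E (expR \o exponent z) *
  tilt E (exponent z) (expR \o (fun x => s^-1 * dotv u x)).
Proof.
rewrite mulrC mulfVK ?gt_eqF ?(mean_expR_gt0 meanE)//.
by congr E; apply/funext => x /=; rewrite exponentD expRD mulrC.
Qed.

(** Makes any point [z] a base point: the change from [z] to [z + u] is a tilt of the mean at [z] by
    a linear form, to which [tilt_sub_le] applies. *)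
Lemma tilt_exponentD z u f : tilt E (exponent (z + u)) f =
  tilt (tilt E (exponent z)) (fun x => s^-1 * dotv u x) f.
Proof.
rewrite [LHS]/tilt partitionD invfM mulrA; congr (_ / _); congr (E _ / _).
by apply/funext => x; rewrite exponentD expRD (mulrC (expR _)) mulrA.
Qed.

(** The ratio of the partition functions at [y] and [x] is the mean at [x] of
    [expR (<y - x, .> / s)]; Jensen bounds it below. *)
Lemma posterior_mean_subgradient x y :
  log_partition x + dotv (posterior_mean x) (y - x) <= log_partition y.
Proof.
have Zx0 : 0 < E (expR \o exponent x) by exact: (mean_expR_gt0 meanE).
have cu := @continuous_linear_form s^-1 (y - x).
have /= J := jensen_expR (mean_tilt x) cu.
have T0 := mean_expR_gt0 (mean_tilt x) cu.
have := partitionD x (y - x); rewrite addrC subrK /log_partition => ->.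
rewrite lnM ?posrE//.
rewrite mulrDr lerD2l dotvC dotv_posterior_mean.
rewrite -ler_pdivrMl// -ler_expR lnK ?posrE//; apply: le_trans J.
by rewrite (meanZ (mean_tilt x))//; exact: continuous_dotv.
Qed.

Lemma posterior_mean_lipschitz x y : enorm (posterior_mean x - posterior_mean y)
  <= M ^+ 2 / s * enorm (x - y).
Proof.
set e := posterior_mean x - posterior_mean y.
have [e0|e_neq0] := eqVneq (enorm e) 0.
  by rewrite e0 !mulr_ge0 ?enorm_ge0// ?invr_ge0 ?exprn_ge0// ltW.
have e_gt0 : 0 < enorm e by rewrite lt0r e_neq0 enorm_ge0.
set d := x - y; set t := M * enorm d / s.
have t0 : 0 <= t by rewrite !mulr_ge0 ?enorm_ge0// ?invr_ge0 ltW.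
(* The difference [e] is tested against itself: on [X], [<e, .>] is bounded by [|e| M] and
   [<a d, .> / s] by [a t]. *)
have small z a : 0 <= a -> dotv e (posterior_mean (z + a *: d)) -
    dotv e (posterior_mean z) <= enorm e * M * (a * t) * expR (a * t) ^+ 2.
  move=> a0; rewrite !dotv_posterior_mean tilt_exponentD.
  apply: (tilt_sub_le (mean_tilt z)).
  - exact: continuous_dotv.
  - exact: continuous_linear_form.
  - by rewrite mulr_gt0.
  - by rewrite mulr_ge0.
  - move=> v /X_bounded vM; apply: le_trans (normr_dotv_le _ _) _.
    by rewrite ler_wpM2l ?enorm_ge0.
  - move=> v /X_bounded vM; rewrite normrM (ger0_norm (_ : 0 <= s^-1)) ?invr_ge0 ?(ltW s_gt0)//.
    rewrite ler_pdivrMl//.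
    apply: le_trans (normr_dotv_le _ _) _; rewrite enormZ//.
    have -> : s * (a * t) = a * enorm d * M by rewrite /t; field; rewrite gt_eqF.
    by rewrite ler_wpM2l// mulr_ge0 ?enorm_ge0.
set c := enorm e * M * t.
(* The exponential loss of [small] is paid at the scale [t / N.+1] of one piece, hence tends to
   1. *)
have subdiv N : dotv e e <= c * expR (t / N.+1%:R) ^+ 2.
  set h : R := N.+1%:R^-1; have h0 : 0 <= h by rewrite invr_ge0.
  have step k : dotv e (posterior_mean (y + (k%:R * h) *: d)) -
      dotv e (posterior_mean y) <= k%:R * h * (c * expR (h * t) ^+ 2).
    elim: k => [|k ih]; first by rewrite !mul0r scale0r addr0 subrr.
    have := small (y + (k%:R * h) *: d) h h0.
    rewrite -addrA -scalerDl -natr1 /c.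
    have -> : k%:R * h + h = (k%:R + 1) * h :> R by ring.
    move: ih; rewrite /c; set q := expR _ ^+ 2; lra.
  have := step N.+1.
  rewrite mulfV ?pnatr_eq0// scale1r mul1r -dotvBr /d (addrC y) subrK -/e.
  by rewrite (mulrC t).
have key : dotv e e <= c.
  (* With [h = t / N.+1], multiplying [subdiv] by [expR (- (2 * h)) >= 1 - 2 * h] gives
     [(1 - 2 * h) * <e, e> <= c]. *)
  apply: (@ler_add_invn _ _ _ (2 * t * dotv e e)) => N.
  have := subdiv N; set h := t / N.+1%:R.
  have -> : 2 * t * dotv e e / N.+1%:R = 2 * h * dotv e e by rewrite /h; ring.
  have := expR_ge1Dx (- (2 * h)).
  have : expR h ^+ 2 * expR (- (2 * h)) = 1.
    by rewrite expr2 -!expRD -[RHS]expR0; congr expR; ring.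
  have q0 := expR_gt0 (- (2 * h)).
  have g0 := dotvv_ge0 e.
  set p := expR h ^+ 2; set q := expR _; move=> pq hq /(ler_wpM2r (ltW q0)).
  rewrite -(mulrA c) -/q pq mulr1 => h1.
  by have := ler_wpM2l g0 hq; lra.
rewrite -(ler_pM2l e_gt0) -expr2 sqr_enorm.
apply: le_trans key _; rewrite /c /t -/d.
by rewrite le_eqVlt; apply/orP; left; apply/eqP; ring.
Qed.

End ExponentialFamily.

(** * Borel measures on compact sets and their support *)

Section Borel.
Variables (R : realType) (n : nat) (mu : probability (borelV R n) R).
Implicit Types (X U : set 'cV[R]_n) (f : 'cV[R]_n -> R).

Lemma open_borelV U : open U -> measurable (U : set (borelV R n)).
Proof. exact: sub_sigma_algebra. Qed.

Lemma compact_borelV X : compact X -> measurable (X : set (borelV R n)).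
Proof.
move=> /(compact_closed (@norm_hausdorff _ _)) /closed_openC /open_borelV mX.
by rewrite -[X]setCK; exact: measurableC.
Qed.

Lemma continuous_borelV f :
  continuous f -> measurable_fun setT (f : borelV R n -> R).
Proof.
move=> /continuousP cf; apply: (measurability _ (RGenOpens.measurableE R)).
move=> _ [_ [a [b ->] <-]]; rewrite setTI; apply: open_borelV.
by apply: cf; exact: interval_open.
Qed.

Lemma continuous_integrable X f : compact X -> continuous f ->
  mu.-integrable (X : set (borelV R n)) (EFin \o f).
Proof.
move=> cX cf; apply: measurable_bounded_integrable.
- exact: compact_borelV.
- by apply: le_lt_trans (probability_le1 _ _) (ltry _); exact: compact_borelV.
- by apply: measurable_funTS; exact: continuous_borelV.
- have /compact_bounded : compact (f @` X).
    by apply: continuous_compact => //; exact: continuous_subspaceT.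
  by move=> [r [rr h]]; exists r; split => // r' rr' x Xx; apply: (h _ rr'); exists x.
Qed.

Lemma mean_functional_Rintegral X : compact X -> mu X = 1%E ->
  mean_functional X (fun f => \int[mu]_(x in X) f x).
Proof.
move=> cX muX; have mX := compact_borelV cX.
have iX f : continuous f -> mu.-integrable (X : set (borelV R n)) (EFin \o f).
  exact: continuous_integrable.
split=> [|f g cf cg|a f cf|f g cf cg fg].
- by rewrite Rintegral_cst// [X in fine X]muX mul1r.
- by rewrite RintegralD//; exact: iX.
- by rewrite RintegralZl//; exact: iX.
- by apply: le_Rintegral => //; exact: iX.
Qed.

(** Every point of [X] has a null open neighbourhood; finitely many of them cover [X], and
    subadditivity concludes. *)
Lemma compact_supp_null X : compact X -> X `&` supp mu = set0 -> mu X = 0%E.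
Proof.
move=> cX X0.
have null x : X x -> exists U, [/\ open U, U x & mu U = 0%E].
  move=> Xx; apply: contrapT => /forallNP hU.
  have : (X `&` supp mu) x.
    split=> // U oU Ux; rewrite lt0e measure_ge0 andbT; apply/eqP => U0.
    exact: (hU U).
  by rewrite X0.
have /choice[U hU] : forall x, exists U, X x -> [/\ open U, U x & mu U = 0%E].
  move=> x; have [/null[U hU]|nXx] := pselect (X x); first by exists U.
  by exists set0.
have := cX; rewrite compact_cover => /(_ _ X U).
case=> [x /hU[]//|x Xx|D DX XU].
  by exists x => //; have [] := hU _ Xx.
apply/eqP; rewrite eq_le measure_ge0 andbT.
have mUD x : [set` D] x -> measurable (U x : set (borelV R n)).
  by move=> /DX /set_mem /hU[oU _ _]; exact: open_borelV.
have := content_sub_fsum mu (finite_fset D) mUD (compact_borelV cX) XU.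
move=> /le_trans; apply.
by rewrite fsbig1// => x /DX /set_mem /hU[].
Qed.

(** The closed set [q <= 0] contains the support. The rest of [X] is the countable union of the
    compact sets [K k], null by [compact_supp_null], so [f] and [g] agree almost everywhere on
    [X]. *)
Lemma Rintegral_supp X (q f g : 'cV[R]_n -> R) : compact X -> continuous q ->
  (forall x, supp mu x -> q x <= 0) ->
  continuous f -> continuous g -> (forall x, X x -> q x <= 0 -> f x = g x) ->
  \int[mu]_(x in X) f x = \int[mu]_(x in X) g x.
Proof.
move=> cX cq q0 cf cg fg; have mX := compact_borelV cX.
pose K k := X `&` [set x | k.+1%:R^-1 <= q x].
have cK k : compact (K k).
  apply: compact_closedI => //.
  exact: (iffLR (continuous_closedP q) cq _ (@closed_ge _ k.+1%:R^-1)).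
have K0 k : mu (K k) = 0%E.
  apply: compact_supp_null => //; rewrite -subset0 => x [[_ /= kq] /q0 qx].
  by have := le_trans kq qx; rewrite invr_le0 lern0.
have N0 : mu.-negligible (\bigcup_k K k : set (borelV R n)).
  apply: negligible_bigcup => k; exists (K k).
  by split; [exact: compact_borelV|exact: K0|exact: subset_refl].
congr fine; apply: ae_eq_integral => //.
- by apply/measurable_EFinP; apply: measurable_funTS; exact: continuous_borelV.
- by apply/measurable_EFinP; apply: measurable_funTS; exact: continuous_borelV.
- apply: negligibleS N0 => x /= /not_implyP[Xx fgx].
  have qx : 0 < q x.
    by rewrite ltNge; apply/negP => /(fg _ Xx) e; apply: fgx; rewrite e.
  have [k] := ltr_add_invr qx; rewrite add0r => kq.
  by exists k => //; split => //=; exact: ltW.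
Qed.

End Borel.

(** The infimum is finite since [K] is admissible, and it is itself admissible: each difference
    quotient is a lower bound of the admissible constants. *)
Lemma lipschitz_constP (R : realType) (n : nat) (V : set 'cV[R]_n)
    (T : 'cV[R]_n -> 'cV[R]_n) (K : R) : 0 <= K ->
  (forall x y, V x -> V y -> enorm (T x - T y) <= K * enorm (x - y)) ->
  [/\ (lipschitz_const V T <= K%:E)%E, 0 <= fine (lipschitz_const V T) &
    forall x y, V x -> V y ->
      enorm (T x - T y) <= fine (lipschitz_const V T) * enorm (x - y)].
Proof.
move=> K0 KT; set L := lipschitz_const V T.
have LK : (L <= K%:E)%E by apply: ereal_inf_lbound; exists K.
have L0 : (0 <= L)%E by apply/ereal_infP => _ [l [l0 _] <-]; rewrite lee_fin.
have Lfin : L \is a fin_num by rewrite ge0_fin_numE// (le_lt_trans LK)// ltry.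
split=> // [|x y Vx Vy]; first exact: fine_ge0.
have [xy0|xy0] := eqVneq (enorm (x - y)) 0.
  by have := KT _ _ Vx Vy; rewrite xy0 !mulr0.
have xy_gt0 : 0 < enorm (x - y) by rewrite lt0r xy0 enorm_ge0.
rewrite -ler_pdivrMr// -lee_fin fineK//.
apply/ereal_infP => _ [l [_ lT] <-].
by rewrite lee_fin ler_pdivrMr//; exact: lT.
Qed.

(** * Linear maps, orthonormal bases and the isotropic kernel *)

Section ContinuousMulmx.
Variables (R : realType) (m n : nat) (A : 'M[R]_(m, n)).

Lemma continuous_mulmx_coord i :
  continuous (fun x : 'cV[R]_n => (A *m x) i 0 : R).
Proof.
have -> : (fun x : 'cV[R]_n => (A *m x) i 0) =
    (fun x => \sum_(j < n) A i j * x j 0) by apply/funext => x; rewrite mxE.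
apply: continuous_sumf => j; apply: continuous_mulf; first exact: continuous_cst.
exact: coord_continuous.
Qed.

Lemma continuous_quadratic_form :
  continuous (fun x : 'cV[R]_n => dotv (A *m x) (A *m x)).
Proof.
by apply: continuous_sumf => i; apply: continuous_mulf;
  exact: continuous_mulmx_coord.
Qed.

End ContinuousMulmx.

Section OrthonormalBasis.
Variables (R : realType) (n r : nat) (V : set 'cV[R]_n) (P : 'M[R]_(n, r)).
Hypothesis hP : orthonormal_basis_cols V P.

Lemma orthonormal_basis_trmx_mul : P^T *m P = 1%:M.
Proof.
apply/matrixP => i j; rewrite !mxE -(hP.1 i j).
by apply: eq_bigr => k _; rewrite !mxE.
Qed.

Lemma orthonormal_basis_projE x : V x <-> P *m P^T *m x = x.
Proof.
rewrite -hP.2; split=> [[u _ <-]|<-]; last by exists (P^T *m x); rewrite ?mulmxA.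
by rewrite mulmxA -(mulmxA P) orthonormal_basis_trmx_mul mulmx1.
Qed.

End OrthonormalBasis.

Lemma gauss_kernelE (R : realType) (n r : nat) (Sigma : 'M[R]_n)
    (P : 'M[R]_(n, r)) (s : R) (v : 'cV[R]_n) : s != 0 ->
  reduced_cov Sigma P = s%:M ->
  gauss_kernel Sigma P v = expR (- (2 * s)^-1 * dotv (P^T *m v) (P^T *m v)).
Proof.
move=> s0 covE; rewrite /gauss_kernel covE invmx_scalar.
congr expR; rewrite mul_mx_scalar -!scalemxAl mxE.
have -> : (v^T *m P *m P^T *m v) 0 0 = dotv (P^T *m v) (P^T *m v).
  rewrite -mulmxA -[v^T *m P]trmxK trmx_mul trmxK mxE.
  by apply: eq_bigr => i _; rewrite mxE.
by field.
Qed.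

(** * Identification of the denoiser and conclusion *)

Theorem proposition4p10 (R : realType) (n r : nat)
    (X : set 'cV[R]_n) (M : R)
    (Sigma : 'M[R]_n) (Pi : 'M[R]_(n, r)) (sigma : R)
    (mu : probability (borelV R n) R)
    (hX : compact X) (hM : 0 < M) (hXM : forall x, X x -> enorm x <= M)
    (hSigma : symmetric_psd Sigma) (hr : r = \rank Sigma)
    (hPi : orthonormal_basis_cols (ran Sigma) Pi)
    (hsigma : 0 < sigma)
    (hcov : reduced_cov Sigma Pi = (sigma ^+ 2)%:M)
    (hmuX : mu X = 1%E)
    (hsupp : conv_hull (supp mu) `<=` ran Sigma) :
  let V := ran Sigma in
  let D := mmse X Sigma Pi mu in
  let L := lipschitz_const V D in
  inv_cocoercive_on V (fine L) D /\ (L <= (M ^+ 2 / sigma ^+ 2)%:E)%E.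
Proof.
move=> V D L; set s := sigma ^+ 2 in hcov *.
have s0 : 0 < s by rewrite exprn_gt0.
pose E f := \int[mu]_(x in X) f x.
have meanE : mean_functional X E by exact: mean_functional_Rintegral.
(* Points of [X] may lie outside [V], and the kernel sees only their projection. *)
pose b x := (2 * s)^-1 * dotv (Pi^T *m x) (Pi^T *m x).
have cb : continuous b.
  apply: continuous_mulf; first exact: continuous_cst.
  exact: continuous_quadratic_form.
have VP x : V x <-> Pi *m Pi^T *m x = x by exact: orthonormal_basis_projE.
have V_closed a x y : V x -> V y -> V (x + a *: y).
  by rewrite !VP => Vx Vy; rewrite mulmxDr -scalemxAr Vx Vy.
have kernelE z x : V z -> gauss_kernel Sigma Pi (z - x) =
    expR (- (2 * s)^-1 * dotv (Pi^T *m z) (Pi^T *m z)) *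
    expR (exponent s b z x).
  move=> Vz; rewrite (gauss_kernelE _ _ hcov) ?gt_eqF// -expRD; congr expR.
  (* For [z] in [V] the projection can be moved onto [z], which it fixes; hence the cross term is
     linear in the full [x]. *)
  have zx : dotv (Pi^T *m z) (Pi^T *m x) = dotv z x.
    by rewrite dotvC dotv_mulmx mulmxA (VP z).1// dotvC.
  rewrite mulmxBr dotvBl !dotvBr (dotvC (Pi^T *m x)) zx /exponent /b.
  by field; rewrite gt_eqF.
have DE z : V z -> D z = posterior_mean s E b z.
  move=> Vz; apply/colP => i; rewrite !mxE.
  set c := expR (- (2 * s)^-1 * dotv (Pi^T *m z) (Pi^T *m z)).
  have cB : continuous (exponent s b z) by exact: continuous_exponent.
  have -> : \int[mu]_(x in X) gauss_kernel Sigma Pi (z - (x : 'cV[R]_n)) =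
      c * E (expR \o exponent s b z).
    rewrite -(meanZ meanE); last exact: continuous_expf.
    by apply: eq_Rintegral => x _; exact: kernelE.
  have -> : \int[mu]_(x in X)
      ((x : 'cV[R]_n) i 0 * gauss_kernel Sigma Pi (z - (x : 'cV[R]_n))) =
      c * E (fun x => x i 0 * expR (exponent s b z x)).
    rewrite -(meanZ meanE).
      by apply: eq_Rintegral => x _; rewrite kernelE// mulrCA.
    apply: continuous_mulf; first exact: coord_continuous.
    exact: continuous_expf.
  have c0 : c != 0 by rewrite gt_eqF ?expR_gt0.
  have Z0 := mean_expR_gt0 meanE cB.
  by rewrite /tilt; field; rewrite c0 gt_eqF.
(* The projection [A] passes inside the integral, where it fixes every point of the support. *)
have DV z : V z -> V (D z).
  move=> Vz; rewrite DE//; apply/VP/colP => i.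
  set A := Pi *m Pi^T.
  have -> : (A *m posterior_mean s E b z) i 0 =
      dotv (row i A)^T (posterior_mean s E b z).
    by rewrite mxE; apply: eq_bigr => j _; rewrite !mxE.
  rewrite (dotv_posterior_mean _ meanE)// mxE /tilt; congr (_ / _).
  have cB : continuous (expR \o exponent s b z).
    by apply: continuous_expf; exact: continuous_exponent.
  (* This [q] is the squared distance to [V], so [q <= 0] holds exactly on [V]. *)
  apply: (Rintegral_supp (q := fun x => dotv ((1%:M - A) *m x) ((1%:M - A) *m x))).
  - exact: hX.
  - exact: continuous_quadratic_form.
  - move=> x xmu.
    have /VP xA : V x by apply: hsupp; exact: sub_smallest xmu.
    have -> : (1%:M - A) *m x = 0 by rewrite mulmxBl mul1mx /A xA subrr.
    by rewrite dotv0l.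
  - by apply: continuous_mulf => //; exact: continuous_dotv.
  - by apply: continuous_mulf => //; exact: coord_continuous.
  - move=> x _ qx; congr (_ * _).
    have : (1%:M - A) *m x = 0.
      by apply: dotvv_eq0; apply: le_anti; rewrite qx dotvv_ge0.
    rewrite mulmxBl mul1mx => /subr0_eq {2}->.
    by rewrite mxE; apply: eq_bigr => j _; rewrite !mxE.
have K0 : 0 <= M ^+ 2 / s by rewrite divr_ge0 ?exprn_ge0// ltW.
have D_lip x y : V x -> V y -> enorm (D x - D y) <= M ^+ 2 / s * enorm (x - y).
  by move=> Vx Vy; rewrite !DE//; exact: (posterior_mean_lipschitz meanE).
have [LK L0 L_lip] := lipschitz_constP K0 D_lip.
split=> //.
have D_sub x y : V x -> V y ->
    log_partition s E b x + dotv (D x) (y - x) <= log_partition s E b y.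
  by move=> Vx Vy; rewrite DE//; exact: (posterior_mean_subgradient meanE).
(* Applied with the least Lipschitz constant itself, not with the bound [M ^+ 2 / s]. *)
have BH := baillon_haddad V_closed DV D_sub L0 L_lip.
split=> [L_neq0|L_eq0 beta beta0].
  have L_gt0 : 0 < fine L by rewrite lt0r L_neq0.
  split=> // [|x z Vx Vz]; first by rewrite invr_gt0.
  by rewrite ler_pdivrMl//; exact: BH.
(* Here [L = 0]: [D] is constant on [V], and both sides vanish for every modulus. *)
split=> // x z Vx Vz.
have /enorm_eq0 -> : enorm (D x - D z) = 0.
  apply: le_anti; rewrite enorm_ge0 andbT.
  by have := L_lip _ _ Vx Vz; rewrite -/L L_eq0 mul0r.
by rewrite enorm0 expr0n mulr0 dotv0l.
Qed.
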